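(* Let $G$ be a finite simple graph, let $uv\in E(G)$, let $H=G-uv$, and let $\ell$ be an integer with $0\le\ell\le|V(G)|$. Let $\mathcal M^+_{\ell}(H)$ be the family of minimum-size $\ell$-leaky PSD forcing sets of $H$, and put \[ r_H(u,v)=\max_{B\in\mathcal M^+_{\ell}(H)}|B\cap\{u,v\}| . \] Then \[ Z^+_{(\ell)}(G)\le Z^+_{(\ell)}(H)+2-r_H(u,v). \] Hence $Z^+_{(\ell)}(G)\le Z^+_{(\ell)}(H)+1$ whenever some member of $\mathcal M^+_{\ell}(H)$ contains an endpoint of $uv$. If $Z^+_{(\ell)}(G)-Z^+_{(\ell)}(H)=2$, then every member of $\mathcal M^+_{\ell}(H)$ contains neither $u$ nor $v$.
   Context: All graphs are finite and simple. $G-uv$ is the graph obtained from $G$ by deleting the edge $uv$ (keeping all vertices). PSD color-change rule on a graph $X$: let $B\subseteq V(X)$ be the current set of blue vertices (all others are white), and let $C$ be the vertex set of a connected component of $X-B$. A blue vertex $x\in B$ may PSD-force a vertex $y\in C$ (turn $y$ blue) when $N_X(x)\cap C=\{y\}$. Forces are applied one after another, recomputing the components of the white graph after each force. A leak is a vertex that is forbidden to perform a force. A set $B\subseteq V(X)$ is an $\ell$-leaky PSD forcing set of $X$ if, for every set $L\subseteq V(X)$ of exactly $\ell$ leaks, starting from the initial blue set $B$ there is a sequence of PSD forces, none performed by a vertex of $L$, after which all vertices of $X$ are blue. $Z^+_{(\ell)}(X)$ denotes the minimum size of an $\ell$-leaky PSD forcing set of $X$, where $0\le\ell\le|V(X)|$.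 *)

(* Defs.v *)
From mathcomp Require Import all_boot.

Set Implicit Arguments.
Unset Strict Implicit.
Unset Printing Implicit Defensive.

(* A finite simple graph is a finType T of vertices with a
   symmetric, irreflexive adjacency relation e : rel T; these two properties
   are hypotheses of theorems, not part of the definitions. *)

Section LeakyPSD.
Variable T : finType.
Implicit Types (e : rel T) (B C L : {set T}) (u v x y : T) (l : nat).

Definition del_edge e u v : rel T :=
  [rel x y | e x y && ([set x; y] != [set u; v])].

Definition nbhd e x : {set T} := [set y | e x y].

Definition white_adj e B : rel T :=
  [rel x y | [&& x \notin B, y \notin B & e x y]].

Definition white_components e B : {set {set T}} :=
  equivalence_partition (connect (white_adj e B)) (~: B).

Definition psd_force e B x y : bool :=
  (x \in B) && [exists C in white_components e B, nbhd e x :&: C == [set y]].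

Definition leaky_step e L : rel {set T} :=
  [rel B B' | [exists x, exists y,
     [&& x \notin L, psd_force e B x y & B' == y |: B]]].

Definition leaky_psd_forcing e l B : bool :=
  [forall (L : {set T} | #|L| == l), connect (leaky_step e L) B [set: T]].

(* The full vertex set is the witness required by [arg min]. *)
Lemma leaky_psd_forcing_setT e l : leaky_psd_forcing e l [set: T].
Proof. by apply/forall_inP => L _; apply: connect0. Qed.

Definition Zpsd e l : nat :=
  #|[arg min_(B < [set: T] | leaky_psd_forcing e l B) #|B|]|.

Definition min_leaky_psd e l : {set {set T}} :=
  [set B | leaky_psd_forcing e l B & #|B| == Zpsd e l].

(* [min_leaky_psd e l] is nonempty, so the default value 0 of \max is never
   what determines the result. *)
Definition max_endpoints e l u v : nat :=
  \max_(B in min_leaky_psd e l) #|B :&: [set u; v]|.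

End LeakyPSD.

(* Main.v *)
(* Making u and v blue neutralises the edge uv: as long as both are blue, G and
   H = G - uv have the same white components and every vertex has the same
   white neighbours.  Since extra blue vertices only shrink white components, a
   forcing sequence of H from B can be replayed in G from B + u + v, so
   Z(G) + |B :&: {u, v}| <= Z(H) + 2 for every minimum forcing set B of H. *)
Require Import Defs.
From mathcomp Require Import all_boot.

Set Implicit Arguments.
Unset Strict Implicit.
Unset Printing Implicit Defensive.

Section ForcingTransfer.
Variable T : finType.
Implicit Types (e : rel T) (B S L : {set T}) (u v x y : T) (l : nat).

(* [agree_off S e e'] ignores the source vertex, so it also controls the white
   neighbours of blue vertices. *)
Definition agree_off S e e' := forall x y, y \notin S -> e x y = e' x y.

Lemma agree_off_sub S S' e e' :
  S \subset S' -> agree_off S e e' -> agree_off S' e e'.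
Proof. by move=> /subsetP sSS' eqe x y yS'; apply: eqe; apply: contra yS' => /sSS'. Qed.

(** A white path avoiding [S] also avoids [B] and uses the same edges in [e] and [e'], so the
    component of [y] off [S] lies inside its component off [B]. Hence [x] sees no new vertex there,
    and it still sees [y]. *)
Lemma psd_force_agree e e' B S x y :
    agree_off S e e' -> B \subset S -> y \notin S ->
  psd_force e B x y -> psd_force e' S x y.
Proof.
move=> eqe /subsetP sBS yS /andP[xB /exists_inP[_ /imsetP[z _ ->] /eqP NxC]].
have: y \in [set y] by rewrite inE.
rewrite -NxC !inE => /and3P[exy _ zy].
apply/andP; split; first exact: sBS.
apply/exists_inP; exists [set t in ~: S | connect (white_adj e' S) y t].
  by apply: imset_f; rewrite inE.
apply/eqP/setP => t; rewrite !inE; apply/and3P/eqP => [[e'xt tS yt]|->].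
  apply/set1P; rewrite -NxC !inE eqe // e'xt.
  rewrite (contra (sBS t) tS) /=.
  apply: connect_trans zy _; apply: connect_sub yt => a b /and3P[aS bS e'ab].
  apply: connect1; rewrite /white_adj /= (contra (sBS a) aS).
  by rewrite (contra (sBS b) bS) eqe.
by rewrite -eqe.
Qed.

(** Each force is replayed by the same vertex [x], so the leaks in [L] are respected. *)
Lemma connect_leaky_step_agree e e' L B B' S :
    agree_off S e e' -> B \subset S -> connect (leaky_step e L) B B' ->
  exists2 S', connect (leaky_step e' L) S S' & B' \subset S'.
Proof.
move=> eqe sBS /connectP[p + ->]; elim: p B S eqe sBS => [|A p IHp] B S eqe sBS /=.
  by exists S.
case/andP=> /existsP[x /existsP[y /and3P[xL Bxy /eqP->]]] pth.
have sBS' : y |: B \subset y |: S by exact: setUS.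
have [|S' SS' ?] := IHp _ (y |: S) _ sBS' pth.
  by apply: agree_off_sub eqe; exact: subsetUr.
(* A force onto a vertex already in [S] is skipped; any other stays valid. *)
exists S' => //; have [yS|yS] := boolP (y \in S).
  by move: SS'; rewrite (setUidPr _) // sub1set.
apply: connect_trans SS'; apply: connect1.
apply/existsP; exists x; apply/existsP; exists y.
by rewrite xL eqxx (psd_force_agree eqe sBS yS Bxy).
Qed.

Lemma leaky_psd_forcing_agree e e' l B S :
    agree_off S e e' -> B \subset S ->
  leaky_psd_forcing e l B -> leaky_psd_forcing e' l S.
Proof.
move=> eqe sBS /forall_inP Bforce; apply/forall_inP => L Ll.
have [S' SS'] := connect_leaky_step_agree eqe sBS (Bforce L Ll).
by rewrite subTset => /eqP S'T; rewrite -S'T.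
Qed.

Lemma agree_off_del_edge e u v S :
  u \in S -> v \in S -> agree_off S (del_edge e u v) e.
Proof.
move=> uS vS x y yS; rewrite /del_edge /= andb_idr // => _.
apply: contra yS => /eqP xyuv.
(* If the pair is the deleted one, its target [y] is [u] or [v], hence in [S]. *)
have : y \in [set x; y] by rewrite !inE eqxx orbT.
by rewrite xyuv => /set2P[] ->.
Qed.

Lemma Zpsd_min e l B : leaky_psd_forcing e l B -> Zpsd e l <= #|B|.
Proof.
rewrite /Zpsd; case: arg_minnP => [|A _ Amin]; last exact: Amin.
exact: leaky_psd_forcing_setT.
Qed.

Lemma min_leaky_psd_neq0 e l : 0 < #|min_leaky_psd e l|.
Proof.
apply/card_gt0P; exists [arg min_(B < [set: T] | leaky_psd_forcing e l B) #|B|].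
rewrite inE /Zpsd eqxx andbT.
by case: arg_minnP => //; exact: leaky_psd_forcing_setT.
Qed.

Lemma Zpsd_del_edge e l u v B :
    B \in min_leaky_psd (del_edge e u v) l ->
  Zpsd e l + #|B :&: [set u; v]| <= Zpsd (del_edge e u v) l + 2.
Proof.
rewrite inE => /andP[Bforce /eqP <-].
have uvforce : leaky_psd_forcing e l (B :|: [set u; v]).
  apply: leaky_psd_forcing_agree Bforce; last exact: subsetUl.
  by apply: agree_off_del_edge; rewrite !inE eqxx ?orbT.
apply: leq_trans (leq_add (Zpsd_min uvforce) (leqnn _)) _.
(* Union and intersection sizes sum to [#|B| + #|[set u; v]|], and the last term is at most 2. *)
by rewrite cardsUI leq_add2l cards2; case: (_ != _).
Qed.

Lemma Zpsd_del_edge_endpoint e l u v B :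
    B \in min_leaky_psd (del_edge e u v) l -> (u \in B) || (v \in B) ->
  Zpsd e l <= Zpsd (del_edge e u v) l + 1.
Proof.
move=> Bmin uvB; rewrite -(leq_add2r 1) -addnA.
apply: leq_trans (Zpsd_del_edge Bmin); rewrite leq_add2l.
by apply/card_gt0P; case/orP: uvB => wB; [exists u | exists v];
  rewrite !inE wB eqxx ?orbT.
Qed.

End ForcingTransfer.

Theorem corollary5 (T : finType) (e : rel T)
    (e_sym : symmetric e) (e_irr : irreflexive e)
    (u v : T) (uv_edge : e u v) (l : nat) (l_le : l <= #|T|) :
  let H := del_edge e u v in
  [/\ Zpsd e l <= Zpsd H l + 2 - max_endpoints H l u v,
      (exists2 B : {set T}, B \in min_leaky_psd H l & (u \in B) || (v \in B)) ->
        Zpsd e l <= Zpsd H l + 1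
    & Zpsd e l - Zpsd H l = 2 ->
        forall B : {set T}, B \in min_leaky_psd H l -> u \notin B /\ v \notin B].
Proof.
move=> H; split.
- have [B Bmin maxB] := eq_bigmax_cond (fun B : {set T} => #|B :&: [set u; v]|)
    (min_leaky_psd_neq0 H l).
  have le_ZH := Zpsd_del_edge Bmin.
  (* Subtraction is truncated, so the maximum must also be shown to be at most [Zpsd H l + 2];
     [le_ZH] gives both. *)
  rewrite /max_endpoints maxB leq_subRL; first by rewrite addnC.
  exact: leq_trans (leq_addl _ _) le_ZH.
- by case=> B; exact: Zpsd_del_edge_endpoint.
- move=> Zdiff B Bmin; apply/andP; rewrite -negb_or.
  apply/negP => /(Zpsd_del_edge_endpoint Bmin).
  (* An endpoint in [B] would bound the difference by 1, leaving [2 <= 1]. *)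
  by rewrite -leq_subLR Zdiff.
Qed.
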